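(* For every $f\in\mathcal{A}(\Omega)$, $$E\left[\Sigma^2(f)\right]\le\sigma^2(f)+\frac14J^2(f),$$ where $J^2(f)=(J(f))^2$.
   Context: Let $\Omega=\prod_{k=1}^n\Omega_k$ be a product of measurable spaces, let $\mu_k$ be a probability measure on $\Omega_k$ and $\mu=\prod_k\mu_k$ the product measure on $\Omega$. $\mathcal{A}(\Omega)$ is the algebra of all bounded measurable real-valued functions on $\Omega$. $Ef=\int_\Omega f\,d\mu$ and $\sigma^2(f)=E[(f-Ef)^2]$. For $k\in\{1,\dots,n\}$ and $y,y'\in\Omega_k$, $(S_y^kf)(x_1,\dots,x_n)=f(x_1,\dots,x_{k-1},y,x_{k+1},\dots,x_n)$ and $D^k_{y,y'}=S^k_y-S^k_{y'}$. $E_kf=\int_{\Omega_k}S_y^kf\,d\mu_k(y)$, $\sigma_k^2(f)=E_k[(f-E_kf)^2]$, and $\Sigma^2(f)=\sum_{k=1}^n\sigma_k^2(f)$. The interaction functional is $$J(f)=\left(\sup_{\mathbf{x}\in\Omega}\sum_{k,l:k\ne l}\ \sup_{z,z'\in\Omega_l}\ \sup_{y,y'\in\Omega_k}\left(D^l_{z,z'}D^k_{y,y'}f\right)^2(\mathbf{x})\right)^{1/2},$$ with $k,l$ ranging over $\{1,\dots,n\}$. *)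

(* Defs.v *)
From HB Require Import structures.
From mathcomp Require Import all_boot all_order all_algebra.
From mathcomp Require Import all_classical all_reals all_analysis.

Set Implicit Arguments.
Unset Strict Implicit.
Unset Printing Implicit Defensive.
Import Order.TTheory GRing.Theory Num.Theory.
Import numFieldNormedType.Exports.
Local Open Scope classical_set_scope.
Local Open Scope ring_scope.

Definition cylinders n (d : 'I_n -> measure_display)
    (T : forall k, measurableType (d k)) : set (set (forall k, T k)) :=
  \bigcup_k preimage_set_system setT (fun x : forall k, T k => x k) measurable.

Arguments cylinders {n d} T.

Notation prodspace T := (g_sigma_algebraType (cylinders T)).

Section coordinates.
Context n (d : 'I_n -> measure_display) (T : forall k, measurableType (d k)).

Lemma measurable_coord (k : 'I_n) :
  measurable_fun setT (fun x : prodspace T => x k).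
Proof.
move=> _ A mA; apply: sub_sigma_algebra; exists k => //; exists A => //.
Qed.

Lemma measurable_into_prodspace d' (U : measurableType d')
    (g : U -> prodspace T) :
  (forall k, measurable_fun setT (fun u => g u k)) -> measurable_fun setT g.
Proof.
move=> mg; apply: (@measurability _ _ _ (prodspace T) setT g (cylinders T)) => // _ [_ [k _ [A mA <-]] <-].
by rewrite setTI; exact: (mg k measurableT A mA).
Qed.

Lemma measurable_box (A : forall k, set (T k)) :
  (forall k, measurable (A k)) ->
  measurable ([set x | forall k, A k (x k)] : set (prodspace T)).
Proof.
move=> mA.
rewrite (_ : [set _ | _] = \bigcap_(k in [set: 'I_n]) [set x | A k (x k)]).
  apply: fin_bigcap_measurable => // k _.
  by rewrite -[X in measurable X]setTI; exact: measurable_coord.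
by apply/seteqP; split=> x /= Ax k; [move=> _; exact: Ax|exact: Ax].
Qed.

End coordinates.

Section dependent_cons.
Context n (T : 'I_n.+1 -> Type).

Definition dcons (a : T ord0) (x : forall k : 'I_n, T (lift ord0 k)) :
    forall k, T k := fun k =>
  match unliftP ord0 k with
  | UnliftSome j kj => ecast i (T i) (esym kj) (x j)
  | UnliftNone k0 => ecast i (T i) (esym k0) a
  end.

Lemma dcons0 a x : dcons a x ord0 = a.
Proof.
rewrite /dcons; case: unliftP => [j e|e]; last by rewrite eq_axiomK.
by exfalso; move/eqP: e; apply/negP; exact: neq_lift.
Qed.

Lemma dconsS a x k : dcons a x (lift ord0 k) = x k.
Proof.
rewrite /dcons; case: unliftP => [j e|e].
  have kj := lift_inj e; move: e; rewrite -kj => e.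
  by rewrite eq_axiomK.
by exfalso; move/esym/eqP: e; apply/negP; exact: neq_lift.
Qed.

End dependent_cons.

Section measurable_dependent_cons.
Context n (d : 'I_n.+1 -> measure_display)
  (T : forall k, measurableType (d k)).

Definition pcons
    (p : T ord0 * prodspace (fun k : 'I_n => T (lift ord0 k))) : prodspace T :=
  dcons p.1 p.2.

Lemma measurable_pcons : measurable_fun setT pcons.
Proof.
apply: measurable_into_prodspace => k; case: (unliftP ord0 k) => [j ->|->].
- rewrite [X in measurable_fun _ X](_ : _ =
      (fun x : prodspace (fun k => T (lift ord0 k)) => x j) \o snd).
    exact: (@measurableT_comp _ _ _ _ _ _ _ _ _
      (@measurable_coord n (fun k => d (lift ord0 k))
        (fun k => T (lift ord0 k)) j) measurable_snd).
  by apply/funext => p; rewrite /pcons dconsS.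
- rewrite [X in measurable_fun _ X](_ : _ = fst)//.
  by apply/funext => p; rewrite /pcons dcons0.
Qed.

HB.instance Definition _ := isMeasurableFun.Build _ _ _ _ pcons measurable_pcons.

End measurable_dependent_cons.

(* The product measure, built by recursion on the number of factors: mu_0
   times the product of the remaining factors, transported along [pcons].
   [prod_measure_box] below is its characteristic property. *)
Fixpoint prod_measure (R : realType) n : forall (d : 'I_n -> measure_display)
    (T : forall k, measurableType (d k)) (mu : forall k, probability (T k) R),
    probability (prodspace T) R :=
  match n with
  | 0 => fun d T mu => \d_(point : prodspace T)
  | n'.+1 => fun d T mu =>
      distribution
        (mu ord0 \x @prod_measure R n' _ (fun k => T (lift ord0 k))
                                         (fun k => mu (lift ord0 k)))%E
        (@pcons n' d T)
  end.

Lemma prod_measure_box (R : realType) n (d : 'I_n -> measure_display)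
    (T : forall k, measurableType (d k)) (mu : forall k, probability (T k) R)
    (A : forall k, set (T k)) : (forall k, measurable (A k)) ->
  prod_measure mu [set x | forall k, A k (x k)] = (\prod_k mu k (A k))%E.
Proof.
elim: n d T mu A => [|n IH] d T mu A mA /=.
  rewrite big_ord0 diracE mem_set//=; by case.
rewrite big_ord_recl /= /distribution /pushforward /=.
rewrite -(IH _ _ (fun k => mu (lift ord0 k))) // -product_measure1E //.
  congr (_ _); apply/seteqP; split=> -[a x] /=.
  - move=> H; split => [|k /=].
      by have := H ord0; rewrite /pcons dcons0.
    by have := H (lift ord0 k); rewrite /pcons dconsS.
  - move=> [/= Ha Hx] k; case: (unliftP ord0 k) => [j ->|->].
      by rewrite /pcons dconsS; exact: Hx.
    by rewrite /pcons dcons0.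
apply: (@measurable_box n _ (fun k => T (lift ord0 k))
  (fun k => A (lift ord0 k))) => k; exact: mA.
Qed.

Section functionals.
Context (R : realType) n (d : 'I_n -> measure_display)
  (T : forall k, measurableType (d k)) (mu : forall k, probability (T k) R).
Implicit Types (f : prodspace T -> R) (x : prodspace T) (k l : 'I_n).

Definition bounded_measurable : set (prodspace T -> R) :=
  [set f : prodspace T -> R |
    measurable_fun setT f /\ [bounded f x | x in [set: prodspace T]]].

Definition subst_at k (y : T k) f : prodspace T -> R :=
  fun x => f (eqtype.dfwith x y).

Definition diff_at k (y y' : T k) f : prodspace T -> R :=
  subst_at y f \- subst_at y' f.

Definition cond_expectation k f : prodspace T -> R :=
  fun x => \int[mu k]_y subst_at y f x.

Definition cond_variance k f : prodspace T -> R :=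
  cond_expectation k (fun x => (f x - cond_expectation k f x) ^+ 2).

Definition sum_cond_variance f : prodspace T -> R :=
  fun x => \sum_(k < n) cond_variance k f x.

(* The suprema are taken in [R]; for a bounded [f] all of them are suprema of
   nonempty bounded sets. *)
Definition interaction f : R :=
  Num.sqrt (sup (range (fun x : prodspace T =>
    \sum_(k < n) \sum_(l < n | k != l)
      sup (range (fun z : T l * T l => sup (range (fun y : T k * T k =>
        (diff_at z.1 z.2 (diff_at y.1 y.2 f) x) ^+ 2))))))).

End functionals.

(* Main.v *)
Require Import Defs.
From HB Require Import structures.
From mathcomp Require Import all_boot all_order all_algebra.
From mathcomp Require Import all_classical all_reals all_analysis.
From mathcomp Require Import measurable_realfun ring lra.

Set Implicit Arguments.
Unset Strict Implicit.
Unset Printing Implicit Defensive.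
Import Order.TTheory GRing.Theory Num.Theory.
Import numFieldNormedType.Exports.
Local Open Scope classical_set_scope.
Local Open Scope ring_scope.

(** Write E_k for averaging over the k-th coordinate, L_k f = f - E_k f, and
    |g|^2 = E[g^2].  The operators E_k preserve E and are pairwise commuting
    orthogonal projections; the average of sigma_k^2(f) is |L_k f|^2, and
    composing all the E_k turns f into the constant E f, so that sigma^2(f) is
    |f - E_1...E_n f|^2.  The theorem is thus a comparison of |f - P f|^2 with
    the sum of the |L_k f|^2, where P is a product of projections.

    Adding a projection E_k in front of P splits the error orthogonally:
    f - E_k P f = L_k f + E_k (f - P f).  Bounding |E_k (f - P f)| by |f - P f|
    gives the Efron-Stein inequality ([efron_stein]),
    |f - P f|^2 <= sum_k |L_k f|^2.  What this step discards is exactly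
    |L_k (f - P f)|^2 = |L_k f - P (L_k f)|^2, which Efron-Stein, applied to
    L_k f, bounds by the sum of the |L_l L_k f|^2.  Hence the reverse
    inequality holds up to second-order terms ([sum_residual_le]):
    sum_k |L_k f|^2 <= |f - P f|^2 + sum_(k != l) |L_k L_l f|^2.

    Finally |L_k L_l f|^2 is the mean of the conditional variance
    sigma_k^2(L_l f).  As a function of its k-th coordinate, L_l f oscillates
    by at most the supremum of the mixed differences |D^l D^k f|, since
    D^k L_l f is the average over z of D^l_(x_l, z) D^k f; Popoviciu's
    inequality ([popoviciu]) then supplies the factor 1/4
    ([cond_variance_residual_le]).  This estimate is pointwise in x, so it can be
    summed over k and l before the supremum over x is taken. *)

(** * Bounded measurable functions and their integrals *)

Definition bmeas {R : realType} {d} {U : measurableType d} (f : U -> R) :=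
  measurable_fun setT f /\ exists M, forall x, `|f x| <= M.

Section bounded_functions.
Context {R : realType} {d} {U : measurableType d}.
Implicit Types f g : U -> R.

Lemma bmeas_cst (c : R) : bmeas (fun _ : U => c).
Proof. by split; [exact: measurable_cst|exists `|c|]. Qed.

Lemma bmeasD f g : bmeas f -> bmeas g -> bmeas (fun x => f x + g x).
Proof.
move=> [mf [M fM]] [mg [N gN]]; split; first exact: measurable_funD.
by exists (M + N) => x; rewrite (le_trans (ler_normD _ _))// lerD.
Qed.

Lemma bmeasB f g : bmeas f -> bmeas g -> bmeas (fun x => f x - g x).
Proof.
move=> [mf [M fM]] [mg [N gN]]; split; first exact: measurable_funB.
by exists (M + N) => x; rewrite (le_trans (ler_normB _ _))// lerD.
Qed.

Lemma bmeasM f g : bmeas f -> bmeas g -> bmeas (fun x => f x * g x).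
Proof.
move=> [mf [M fM]] [mg [N gN]]; split; first exact: measurable_funM.
by exists (M * N) => x; rewrite normrM ler_pM.
Qed.

Lemma bmeasX2 f : bmeas f -> bmeas (fun x => f x ^+ 2).
Proof. by move=> bf; under eq_fun do rewrite expr2; exact: bmeasM. Qed.

Lemma bmeas_sum (I : Type) (r : seq I) (p : pred I) (F : I -> U -> R) :
  (forall i, bmeas (F i)) -> bmeas (fun x => \sum_(i <- r | p i) F i x).
Proof.
move=> bF; elim: r => [|i r IH].
  by under eq_fun do rewrite big_nil; exact: bmeas_cst.
under eq_fun do rewrite big_cons; case: (p i) => //; exact: bmeasD.
Qed.

Lemma bmeas_comp d' (V : measurableType d') (h : V -> U) f :
  measurable_fun setT h -> bmeas f -> bmeas (f \o h).
Proof.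
move=> mh [mf [M fM]]; split; first exact: measurableT_comp.
by exists M => x; exact: fM.
Qed.

Lemma bmeas_integrable (P : probability U R) f :
  bmeas f -> P.-integrable setT (EFin \o f).
Proof.
move=> [mf [M fM]]; apply: measurable_bounded_integrable => //.
  exact: fin_num_fun_lty.
exists M; split; first exact: num_real.
by move=> x Mx y _; exact/(le_trans (fM y))/ltW.
Qed.

End bounded_functions.

Ltac prove_bmeas := by move=> *;
  do ?[exact: bmeas_cst|solve [auto]|apply: bmeasX2|apply: bmeasM|
       apply: bmeasB|apply: bmeasD|apply: bmeas_sum].

Section integral_of_bounded.
Context {R : realType} {d} {U : measurableType d} (P : probability U R).
Implicit Types f g : U -> R.

Let intb f (bf : bmeas f) := bmeas_integrable P bf.

Lemma Rint_cst c : \int[P]_x c = c :> R.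
Proof.
rewrite Rintegral_cst// (_ : fine _ = 1) ?mulr1//.
by rewrite [X in fine X]probability_setT.
Qed.

Lemma RintD f g : bmeas f -> bmeas g ->
  \int[P]_x (f x + g x) = \int[P]_x f x + \int[P]_x g x.
Proof. by move=> /intb ? /intb ?; rewrite RintegralD. Qed.

Lemma RintB f g : bmeas f -> bmeas g ->
  \int[P]_x (f x - g x) = \int[P]_x f x - \int[P]_x g x.
Proof. by move=> /intb ? /intb ?; rewrite RintegralB. Qed.

Lemma RintZ c f : bmeas f -> \int[P]_x (c * f x) = c * \int[P]_x f x.
Proof. by move=> /intb ?; rewrite RintegralZl. Qed.

Lemma Rint_sum (I : Type) (r : seq I) (p : pred I) (F : I -> U -> R) :
  (forall i, bmeas (F i)) ->
  \int[P]_x (\sum_(i <- r | p i) F i x) =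
  \sum_(i <- r | p i) \int[P]_x F i x.
Proof.
move=> bF; elim: r => [|i r IH].
  by rewrite big_nil; under eq_Rintegral do rewrite big_nil; rewrite Rint_cst.
under eq_Rintegral do rewrite big_cons.
rewrite big_cons; case: (p i) => //.
by rewrite RintD ?IH//; exact: bmeas_sum.
Qed.

Lemma Rint_le f g : bmeas f -> bmeas g -> (forall x, f x <= g x) ->
  \int[P]_x f x <= \int[P]_x g x.
Proof. by move=> /intb ? /intb ? fg; apply: le_Rintegral. Qed.

Lemma Rint_norm_le f M : bmeas f -> (forall x, `|f x| <= M) ->
  `|\int[P]_x f x| <= M.
Proof.
move=> bf fM; have bM := @bmeas_cst R _ U.
have /all_and2[lo hi] x : - M <= f x /\ f x <= M.
  by apply/andP; rewrite -ler_norml.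
rewrite ler_norml -[leLHS]Rint_cst -[X in _ && (_ <= X)]Rint_cst.
by apply/andP; split; exact: Rint_le.
Qed.

Lemma EFin_Rint f : bmeas f -> (\int[P]_x (f x)%:E)%E = (\int[P]_x f x)%:E.
Proof. by move=> /intb ?; rewrite fineK//; exact: integrable_fin_num. Qed.

(** The variance is the least mean square deviation from a constant; the
    midpoint of the range of [f] deviates from [f] by at most [M / 2]. *)
Lemma popoviciu f M : bmeas f -> (forall x y, `|f x - f y| <= M) ->
  \int[P]_x (f x - \int[P]_x f x) ^+ 2 <= M ^+ 2 / 4.
Proof.
move=> bf fM; have [mf [N fN]] := bf.
have hinf : has_inf (range f).
  split; first by exists (f point), point.
  by exists (- N) => _ [x _ <-]; have := fN x; rewrite ler_norml => /andP[].
(* [c] is the midpoint of an interval of length [M] containing the range. *)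
pose c := inf (range f) + M / 2.
have lo x : inf (range f) <= f x by apply: ge_inf; [case: hinf|exists x].
have hi x : f x <= inf (range f) + M.
  rewrite -lerBlDr; apply: lb_le_inf; first by case: hinf.
  by move=> _ [y _ <-]; have := fM x y; rewrite ler_norml => /andP[]; lra.
set m := \int[P]_x f x.
have -> : \int[P]_x (f x - m) ^+ 2 = \int[P]_x (f x - c) ^+ 2 - (m - c) ^+ 2.
  have e x : (f x - m) ^+ 2 =
      (f x - c) ^+ 2 - (2 * (m - c) * f x - (m ^+ 2 - c ^+ 2)).
    by ring.
  under eq_Rintegral do rewrite e.
  by rewrite RintB ?RintB ?RintZ ?Rint_cst -/m //; [ring|prove_bmeas..].
apply: (@le_trans _ _ (\int[P]_x (f x - c) ^+ 2)).
  by rewrite lerBlDr lerDl sqr_ge0.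
rewrite -[leRHS]Rint_cst; apply: Rint_le; [prove_bmeas..|].
by move=> x; have := lo x; have := hi x; rewrite /c; nra.
Qed.

End integral_of_bounded.

Section fubini_bounded.
Context {R : realType} {d1 d2} {U : measurableType d1} {V : measurableType d2}.
Variables (P : probability U R) (Q : probability V R) (f : U * V -> R).
Hypothesis bf : bmeas f.

Let intf : (P \x Q)%E.-integrable setT (EFin \o f).
Proof. exact: (bmeas_integrable (P \x Q)%E bf). Qed.

Let section_l x : bmeas (fun y => f (x, y)).
Proof. exact: (bmeas_comp (pair1_measurable x)). Qed.

Let section_r y : bmeas (fun x => f (x, y)).
Proof. exact: (bmeas_comp (pair2_measurable y)). Qed.

Let pmE x : (\int[Q]_y (f (x, y))%:E)%E = (\int[Q]_y f (x, y))%:E.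
Proof. by rewrite EFin_Rint. Qed.

Lemma bmeas_Rint : bmeas (fun x => \int[Q]_y f (x, y)).
Proof.
split.
  apply/measurable_EFinP.
  have := measurable_fubini_F intf.
  by apply: eq_measurable_fun => x _; rewrite /fubini_F/= pmE.
have [_ [M fM]] := bf.
by exists M => x; apply: Rint_norm_le.
Qed.

Lemma Rint_prod : \int[P]_x \int[Q]_y f (x, y) = \int[(P \x Q)%E]_p f p.
Proof.
congr fine; rewrite -[RHS](integral12_prod_meas1 intf).
by apply: eq_integral => x _; rewrite /fubini_F/= pmE.
Qed.

Lemma Rint_swap :
  \int[P]_x \int[Q]_y f (x, y) = \int[Q]_y \int[P]_x f (x, y).
Proof.
have := Fubini intf => /= /(congr1 fine).
under eq_integral do rewrite pmE.
by under [X in _ = fine X]eq_integral do rewrite EFin_Rint//.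
Qed.

End fubini_bounded.

(** * Averaging over one coordinate *)

Section resampling.
Context {n : nat} {d : 'I_n -> measure_display}
  {T : forall k, measurableType (d k)}.
Implicit Types (x : prodspace T) (k l : 'I_n).

Lemma dfwith_id k x : eqtype.dfwith x (x k) = x.
Proof. by apply: functional_extensionality_dep => j; case: eqtype.dfwithP. Qed.

Lemma dfwith2 k x (y y' : T k) :
  eqtype.dfwith (eqtype.dfwith x y) y' = eqtype.dfwith x y'.
Proof.
apply: functional_extensionality_dep => j.
by case: eqtype.dfwithP => [|i ki];
  rewrite ?eqtype.dfwith_in ?eqtype.dfwith_out.
Qed.

Lemma dfwithC k l x (y : T k) (z : T l) : k != l ->
  eqtype.dfwith (eqtype.dfwith x y) z = eqtype.dfwith (eqtype.dfwith x z) y.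
Proof.
move=> kl; apply: functional_extensionality_dep => j.
have [<-{j}|lj] := eqVneq l j.
  by rewrite eqtype.dfwith_in eqtype.dfwith_out ?eqtype.dfwith_in.
have [<-{j lj}|kj] := eqVneq k j.
  by rewrite eqtype.dfwith_out 1?eq_sym// !eqtype.dfwith_in.
by rewrite !eqtype.dfwith_out.
Qed.

Definition resample k (p : prodspace T * T k) : prodspace T :=
  eqtype.dfwith p.1 p.2.

Lemma measurable_resample k : measurable_fun setT (@resample k).
Proof.
apply: measurable_into_prodspace => j; have [<-{j}|kj] := eqVneq k j.
  rewrite (_ : (fun _ => _) = snd)//.
  by apply/funext => p; rewrite /resample eqtype.dfwith_in.
rewrite (_ : (fun _ => _) = (fun x : prodspace T => x j) \o fst).
  by apply: measurableT_comp => //; exact: measurable_coord.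
by apply/funext => p; rewrite /resample eqtype.dfwith_out.
Qed.

Arguments measurable_resample : clear implicits.

HB.instance Definition _ k :=
  isMeasurableFun.Build _ _ _ _ (@resample k) (measurable_resample k).

Context {R : realType} (mu : forall k, probability (T k) R).

(** Boxes are stable under intersection and generate the product
    sigma-algebra. *)
Lemma prod_measure_unique (m : probability (prodspace T) R) :
  (forall A : forall k, set (T k), (forall k, measurable (A k)) ->
    m [set x | forall k, A k (x k)] = (\prod_k mu k (A k))%E) ->
  forall E, measurable E -> m E = prod_measure mu E.
Proof.
move=> mbox E mE.
pose boxes : set (set (prodspace T)) :=
  [set B | exists A : forall k, set (T k), (forall k, measurable (A k)) /\
     B = [set x | forall k, A k (x k)]].
have sub : <<s boxes >> E.
  apply: (smallest_sub _ _ mE); first exact: smallest_sigma_algebra.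
  move=> _ [k _ [A mA <-]]; apply: sub_sigma_algebra.
  (* A cylinder is the box all of whose sides but the [k]-th are full. *)
  exists (eqtype.dfwith (fun j => [set: T j]) A); split.
    by move=> j; case: eqtype.dfwithP.
  rewrite setTI; apply/seteqP; split => x /=.
    by move=> Ax j; case: eqtype.dfwithP.
  by move=> /(_ k); rewrite eqtype.dfwith_in.
refine (@g_sigma_algebra_measure_unique _ R (prodspace T) boxes _ (fun=> setT)
  _ _ m (prod_measure mu) _ _ _ E sub).
- by move=> _ [A [mA ->]]; exact: measurable_box.
- by move=> _; exists (fun=> setT); split => //; apply/seteqP.
- by rewrite bigcup_const//; exists 0%N.
- move=> _ _ [A [mA ->]] [B [mB ->]]; exists (fun k => A k `&` B k); split.
    by move=> k; exact: measurableI.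
  apply/seteqP; split => x /=; first by move=> [Ax Bx] k; split.
  by move=> AB; split=> k; case: (AB k).
- move=> _ [A [mA ->]].
  exact: (etrans (mbox A mA) (esym (prod_measure_box mu mA))).
- move=> _; apply: (@le_lt_trans _ _ 1%E); last exact: ltry.
  exact: probability_le1.
Qed.

(** The pullback of a box is again a box: its [k]-th side moves to the
    fresh coordinate and is replaced by the full space. *)
Lemma resample_prod_measure k E : measurable E ->
  (prod_measure mu \x mu k)%E (@resample k @^-1` E) = prod_measure mu E.
Proof.
move: E; apply: (@prod_measure_unique
  (distribution (prod_measure mu \x mu k)%E (@resample k))) => A mA.
pose B : forall j, set (T j) := eqtype.dfwith A [set: T k].
rewrite /distribution /pushforward/=.
rewrite (_ : _ @^-1` _ = [set x | forall j, B j (x j)] `*` A k); last first.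
  apply/seteqP; split=> -[x y] /=.
    move=> H; split => [j|]; last first.
      by have := H k; rewrite /resample/= eqtype.dfwith_in.
    rewrite /B; case: eqtype.dfwithP => // i ki.
    by have := H i; rewrite /resample/=
      eqtype.dfwith_out.
  move=> [Bx Ay] j; rewrite /resample/=; case: eqtype.dfwithP => // i ki.
  by have := Bx i; rewrite /B eqtype.dfwith_out.
have mB j : measurable (B j) by rewrite /B; case: eqtype.dfwithP.
transitivity (prod_measure mu [set x | forall j, B j (x j)] * mu k (A k))%E.
  by apply: product_measure1E; [exact: measurable_box|exact: mA].
rewrite prod_measure_box// (bigD1 k)//= [RHS](bigD1 k)//=.
rewrite /B eqtype.dfwith_in probability_setT mul1e muleC; congr (_ * _)%E.
by apply: eq_bigr => j jk; rewrite eqtype.dfwith_out// eq_sym.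
Qed.

Local Notation ce := (cond_expectation mu).
Implicit Types f g : prodspace T -> R.

Lemma bmeas_subst f k x : bmeas f ->
  bmeas (fun y : T k => f (eqtype.dfwith x y)).
Proof.
move=> bf; exact: (bmeas_comp
  (measurableT_comp (measurable_resample k) (pair1_measurable x)) bf).
Qed.

Lemma bmeas_ce f k : bmeas f -> bmeas (ce k f).
Proof.
move=> bf; apply: (@bmeas_Rint _ _ _ _ _ (prod_measure mu) (mu k)
  (f \o @resample k)).
exact: (bmeas_comp (measurable_resample k)).
Qed.

(** Tower property, from the invariance of the product measure under
    replacing one coordinate by an independent copy. *)
Lemma Rint_ce f k : bmeas f ->
  \int[prod_measure mu]_x ce k f x = \int[prod_measure mu]_x f x.
Proof.
move=> bf.
have bfr : bmeas (f \o @resample k).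
  exact: (bmeas_comp (measurable_resample k)).
rewrite [LHS](Rint_prod (prod_measure mu) (mu k) bfr); congr fine.
transitivity
  (\int[pushforward (prod_measure mu \x mu k) (@resample k)]_x (f x)%:E)%E.
  rewrite (integral_pushforward (measurable_resample k))//.
    by apply/measurable_EFinP; case: bf.
  exact: (bmeas_integrable (prod_measure mu \x mu k)%E bfr).
by apply: eq_measure_integral => E mE _; exact: resample_prod_measure.
Qed.

Lemma ceB k f g : bmeas f -> bmeas g ->
  ce k (fun x => f x - g x) = (fun x => ce k f x - ce k g x).
Proof.
move=> bf bg; apply/funext => x.
by rewrite /cond_expectation -RintB//; exact: bmeas_subst.
Qed.

Lemma ce_dfwith k f x (y : T k) : ce k f (eqtype.dfwith x y) = ce k f x.
Proof. by apply: eq_Rintegral => z _; rewrite /subst_at dfwith2. Qed.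

Lemma ceM k f g : (forall x (y : T k), g (eqtype.dfwith x y) = g x) ->
  bmeas f ->
  ce k (fun x => g x * f x) = (fun x => g x * ce k f x).
Proof.
move=> gk bf; apply/funext => x.
rewrite /cond_expectation -RintZ; last exact: bmeas_subst.
by apply: eq_Rintegral => y _; rewrite /subst_at gk.
Qed.

Lemma ce_const k g : (forall x (y : T k), g (eqtype.dfwith x y) = g x) ->
  ce k g = g.
Proof.
move=> gk; apply/funext => x; rewrite -[RHS](Rint_cst (mu k)).
by apply: eq_Rintegral => y _; rewrite /subst_at gk.
Qed.

(** Fubini: substitutions at distinct coordinates commute. *)
Lemma ceC k l f : bmeas f -> ce k (ce l f) = ce l (ce k f).
Proof.
move=> bf; have [->//|kl] := eqVneq k l.
apply/funext => x; rewrite /cond_expectation /subst_at.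
have m1 : measurable_fun setT (fun p : T k * T l => resample (x, p.1)).
  exact: (measurableT_comp (measurableT_comp (measurable_resample k)
    (pair1_measurable x)) measurable_fst).
have m2 : measurable_fun setT
    (fun p : T k * T l => resample (resample (x, p.1), p.2)).
  exact: (measurableT_comp (measurable_resample l)
    (measurable_fun_pair m1 measurable_snd)).
rewrite (Rint_swap (mu k) (mu l) (bmeas_comp m2 bf)).
apply: eq_Rintegral => z _; apply: eq_Rintegral => y _.
by rewrite /resample/= dfwithC.
Qed.

End resampling.
(** * Orthogonality and second-order Efron-Stein *)

Section square_norms.
Context {R : realType} {n : nat} {d : 'I_n -> measure_display}
  {T : forall k, measurableType (d k)} (mu : forall k, probability (T k) R).
Implicit Types (f g : prodspace T -> R) (k l : 'I_n) (s : seq 'I_n).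
Local Notation ce := (cond_expectation mu).

Definition sqnorm f : R := \int[prod_measure mu]_x f x ^+ 2.

Definition residual k f := fun x => f x - ce k f x.

Definition iter_ce s f := foldr ce f s.

Lemma sqnorm_ge0 f : 0 <= sqnorm f.
Proof. by apply: Rintegral_ge0 => x _; exact: sqr_ge0. Qed.

Lemma bmeas_residual k f : bmeas f -> bmeas (residual k f).
Proof. by move=> bf; apply: bmeasB => //; exact: bmeas_ce. Qed.

Lemma bmeas_iter_ce s f : bmeas f -> bmeas (iter_ce s f).
Proof. by move=> bf; elim: s => //= k s; exact: bmeas_ce. Qed.

Lemma ce_residual k f : bmeas f -> ce k (residual k f) = fun=> 0.
Proof.
move=> bf; rewrite ceB//; last exact: bmeas_ce.
by rewrite (ce_const mu (ce_dfwith mu f)); apply/funext => x; rewrite subrr.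
Qed.

(** The cross term vanishes already after averaging over the [k]-th
    coordinate, through which the factor [f] can be pulled out. *)
Lemma sqnorm_pythagoras k f g : bmeas f -> bmeas g ->
  (forall x (y : T k), f (eqtype.dfwith x y) = f x) -> ce k g = (fun=> 0) ->
  sqnorm (fun x => f x + g x) = sqnorm f + sqnorm g.
Proof.
move=> bf bg fk g0; rewrite /sqnorm.
have fg0 : \int[prod_measure mu]_x (f x * g x) = 0.
  rewrite -(Rint_ce mu k) ?ceM//; last exact: bmeasM.
  by rewrite g0; under eq_Rintegral do rewrite mulr0; rewrite Rint_cst.
under eq_Rintegral do rewrite sqrrD -addrA [_ + g _ ^+ 2]addrC addrA -mulr_natl.
have [b1 b2] := (bmeasX2 bf, bmeasX2 bg); have b3 := bmeasM bf bg.
rewrite RintD; [|exact: bmeasD|by apply: bmeasM => //; exact: bmeas_cst].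
by rewrite RintD// RintZ// fg0 mulr0 addr0.
Qed.

Lemma sqnorm_ce k f : bmeas f ->
  sqnorm f = sqnorm (ce k f) + sqnorm (residual k f).
Proof.
move=> bf; rewrite -(sqnorm_pythagoras (k := k)).
- by congr sqnorm; apply/funext => x; rewrite /residual addrC subrK.
- exact: bmeas_ce.
- exact: bmeas_residual.
- exact: ce_dfwith.
- exact: ce_residual.
Qed.

Lemma iter_ce_ce s k f : bmeas f -> iter_ce s (ce k f) = ce k (iter_ce s f).
Proof.
by move=> bf; elim: s => //= l s ->; rewrite ceC//; exact: bmeas_iter_ce.
Qed.

Lemma iter_ceB s f g : bmeas f -> bmeas g ->
  iter_ce s (fun x => f x - g x) = (fun x => iter_ce s f x - iter_ce s g x).
Proof.
by move=> bf bg; elim: s => //= k s ->; rewrite ceB//; exact: bmeas_iter_ce.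
Qed.

(** Commutation of the averages lets the residual pass through [f - P f], so
    that Efron-Stein can be applied to [residual k f] below. *)
Lemma residual_sub_iter k s f : bmeas f ->
  residual k (fun x => f x - iter_ce s f x) =
  (fun x => residual k f x - iter_ce s (residual k f) x).
Proof.
move=> bf; have bs := bmeas_iter_ce s bf; have bk := bmeas_ce mu k bf.
rewrite /residual ceB// iter_ceB// iter_ce_ce//.
by apply/funext => x; ring.
Qed.

(** Orthogonal splitting of the error when one more average is applied:
    f - E_k P f = E_k (f - P f) + L_k f. *)
Lemma sqnorm_sub_iter_cons k s f : bmeas f ->
  sqnorm (fun x => f x - iter_ce (k :: s) f x) =
  sqnorm (ce k (fun x => f x - iter_ce s f x)) + sqnorm (residual k f).
Proof.
move=> bf; have bs := bmeas_iter_ce s bf.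
have bfs := bmeasB bf bs; have bk := bmeas_ce mu k bf.
rewrite -(sqnorm_pythagoras (k := k)).
- by congr sqnorm; apply/funext => x; rewrite /residual ceB//=; ring.
- exact: bmeas_ce.
- exact: bmeas_residual.
- exact: ce_dfwith.
- exact: ce_residual.
Qed.

(** Each splitting [sqnorm_sub_iter_cons] loses something only because E_k
    contracts the norm. *)
Lemma efron_stein s f : bmeas f ->
  sqnorm (fun x => f x - iter_ce s f x) <= \sum_(k <- s) sqnorm (residual k f).
Proof.
move=> bf; elim: s => [|k s IH].
  rewrite big_nil /sqnorm; under eq_Rintegral do rewrite subrr expr2 mulr0.
  by rewrite Rint_cst.
rewrite big_cons sqnorm_sub_iter_cons// addrC lerD2l (le_trans _ IH)//.
rewrite (sqnorm_ce k (bmeasB bf (bmeas_iter_ce s bf))) lerDl; exact: sqnorm_ge0.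
Qed.

(** Reverse of [efron_stein]: the loss at step [k] is the norm of
    [residual k f] minus its own iterated average, which [efron_stein] bounds
    by second-order residuals with the coordinate [k] and the later ones. *)
Lemma sum_residual_le s f : uniq s -> bmeas f ->
  \sum_(k <- s) sqnorm (residual k f) <=
  sqnorm (fun x => f x - iter_ce s f x) +
  \sum_(k <- s) \sum_(l <- s | k != l) sqnorm (residual k (residual l f)).
Proof.
move=> us bf; elim: s us => [_|k s IH /= /andP[ks us]].
  by rewrite !big_nil addr0; exact: sqnorm_ge0.
set h := fun x => f x - iter_ce s f x in IH *.
have bh : bmeas h by exact: bmeasB (bmeas_iter_ce s bf).
have hk : sqnorm (residual k h) <=
    \sum_(l <- s) sqnorm (residual l (residual k f)).
  by rewrite /h residual_sub_iter//; apply: efron_stein; exact: bmeas_residual.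
have : sqnorm h = sqnorm (ce k h) + sqnorm (residual k h) by exact: sqnorm_ce.
have -> := sqnorm_sub_iter_cons k s bf; rewrite -/h => hE.
(* The pairs with first index [k] are dropped, being nonnegative. *)
have pairs : \sum_(l <- s) sqnorm (residual l (residual k f)) +
    \sum_(i <- s) \sum_(j <- s | i != j) sqnorm (residual i (residual j f)) <=
    \sum_(i <- k :: s) \sum_(j <- k :: s | i != j)
      sqnorm (residual i (residual j f)).
  rewrite [leRHS]big_cons addrC -[X in X <= _]add0r lerD//.
    by apply: sumr_ge0 => j _; exact: sqnorm_ge0.
  rewrite addrC -big_split/= big_seq [leRHS]big_seq ler_sum// => i si.
  by rewrite big_cons; case: eqP si ks => [->->//|_ _ _]; rewrite lexx.
rewrite big_cons addrC [leRHS]addrAC lerD2r (le_trans (IH us))//.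
by rewrite hE -addrA lerD2l (le_trans _ pairs)// lerD2r.
Qed.

End square_norms.
(** * The interaction functional *)

Section mixed_differences.
Context {R : realType} {n : nat} {d : 'I_n -> measure_display}
  {T : forall k, measurableType (d k)}.
Implicit Types (f : prodspace T -> R) (x : prodspace T) (k l : 'I_n).

Definition mixed_diff_sup k l f x : R :=
  sup (range (fun z : T l * T l => sup (range (fun y : T k * T k =>
    (diff_at z.1 z.2 (diff_at y.1 y.2 f) x) ^+ 2)))).

Section bounded.
Variables (f : prodspace T -> R) (M : R).
Hypothesis fM : forall x, `|f x| <= M.

Let mixed_diff_le k l x (z : T l * T l) (y : T k * T k) :
  diff_at z.1 z.2 (diff_at y.1 y.2 f) x ^+ 2 <= (4 * M) ^+ 2.
Proof.
have M4 : 0 <= 4 * M by rewrite mulr_ge0// (le_trans _ (fM x)).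
rewrite -[leLHS]real_normK ?num_real// lerXn2r ?nnegrE// /diff_at /subst_at.
rewrite (le_trans (ler_normB _ _))// (_ : 4 * M = 2 * M + 2 * M); last by ring.
by apply: lerD; rewrite (le_trans (ler_normB _ _))// mulr_natl mulr2n lerD.
Qed.

Let inner_le k l x (z : T l * T l) :
  sup (range (fun y : T k * T k =>
    diff_at z.1 z.2 (diff_at y.1 y.2 f) x ^+ 2)) <= (4 * M) ^+ 2.
Proof.
apply: ge_sup; first by eexists; exists (point, point).
by move=> _ [y _ <-]; exact: (mixed_diff_le _ z).
Qed.

Lemma mixed_diff_sup_bound k l x : mixed_diff_sup k l f x <= (4 * M) ^+ 2.
Proof.
apply: ge_sup; first by eexists; exists point.
by move=> _ [z _ <-].
Qed.

Lemma sqr_diff_le_mixed_diff_sup k l x (z : T l * T l) (y : T k * T k) :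
  diff_at z.1 z.2 (diff_at y.1 y.2 f) x ^+ 2 <= mixed_diff_sup k l f x.
Proof.
apply: (@le_trans _ _ (sup (range (fun y : T k * T k =>
    diff_at z.1 z.2 (diff_at y.1 y.2 f) x ^+ 2)))).
  apply: ub_le_sup; last by exists y.
  by exists ((4 * M) ^+ 2) => _ [y' _ <-]; exact: (mixed_diff_le _ z).
apply: ub_le_sup; last by exists z.
by exists ((4 * M) ^+ 2) => _ [z' _ <-].
Qed.

Lemma mixed_diff_sup_ge0 k l x : 0 <= mixed_diff_sup k l f x.
Proof.
exact: le_trans (sqr_ge0 _)
  (sqr_diff_le_mixed_diff_sup x (point, point) (point, point)).
Qed.

Lemma sum_mixed_diff_sup_le x :
  \sum_(k < n) \sum_(l < n | k != l) mixed_diff_sup k l f x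
    <= interaction f ^+ 2.
Proof.
set S := fun x => \sum_(k < n) \sum_(l < n | k != l) mixed_diff_sup k l f x.
have Sle x' : S x' <= sup (range S).
  apply: ub_le_sup; last by exists x'.
  exists (\sum_(k < n) \sum_(l < n | k != l) (4 * M) ^+ 2) => _ [x'' _ <-].
  by apply: ler_sum => k _; apply: ler_sum => l _; exact: mixed_diff_sup_bound.
rewrite /interaction sqr_sqrtr; first exact: Sle.
apply: le_trans (Sle x); apply: sumr_ge0 => k _; apply: sumr_ge0 => l _.
exact: mixed_diff_sup_ge0.
Qed.

(** Popoviciu's inequality in the [k]-th coordinate: the increment of
    [residual l f] between two values of that coordinate is an average of mixed
    differences of [f]. *)
Lemma cond_variance_residual_le (mu : forall k, probability (T k) R) k l x :
  measurable_fun setT f -> k != l ->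
  cond_variance mu k (residual mu l f) x <= mixed_diff_sup k l f x / 4.
Proof.
move=> mf kl; have bf : bmeas f by split => //; exists M.
set c := mixed_diff_sup k l f x.
pose h (y : T k) := residual mu l f (eqtype.dfwith x y).
have bh : bmeas h by apply: bmeas_subst; exact: bmeas_residual.
have -> : cond_variance mu k (residual mu l f) x =
    \int[mu k]_y (h y - \int[mu k]_y h y) ^+ 2.
  by apply: eq_Rintegral => y _; rewrite /subst_at ce_dfwith.
have c0 : 0 <= c by exact: mixed_diff_sup_ge0.
rewrite -(sqr_sqrtr c0); apply: popoviciu => // y y'.
have bz y0 : bmeas (fun z : T l => f (eqtype.dfwith (eqtype.dfwith x y0) z)).
  exact: bmeas_subst.
(* [f] itself is a value of [subst_at], at [x l]: hence the first index. *)
have -> : h y - h y' = \int[mu l]_z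
   diff_at (x l) z (diff_at y y' f) x.
  rewrite /h /residual /cond_expectation /subst_at.
  rewrite -[X in X - _ - _](Rint_cst (mu l)).
  rewrite -[X in _ - (X - _)](Rint_cst (mu l)).
  rewrite -!RintB//; [|prove_bmeas..].
  apply: eq_Rintegral => z _; rewrite /diff_at /subst_at/= dfwith_id.
  by rewrite !(dfwithC _ _ z kl); ring.
apply: Rint_norm_le.
  apply: (@bmeasB _ _ _ (fun=> diff_at y y' f (eqtype.dfwith x (x l)))
    (fun z => diff_at y y' f (eqtype.dfwith x z))); first exact: bmeas_cst.
  rewrite /diff_at /subst_at; apply: bmeasB.
    by under eq_fun do rewrite -dfwithC//.
  by under eq_fun do rewrite -dfwithC//.
move=> z; rewrite -sqrtr_sqr; apply: ler_wsqrtr.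
exact: (sqr_diff_le_mixed_diff_sup x (x l, z) (y, y')).
Qed.

End bounded.
End mixed_differences.

(** * Averaging over all coordinates *)

Section constants.
Context {R : realType} {n : nat} {d : 'I_n -> measure_display}
  {T : forall k, measurableType (d k)} (mu : forall k, probability (T k) R).
Implicit Types (f g : prodspace T -> R).

(** Two points are joined by changing one coordinate at a time. *)
Lemma invariant_constant g :
  (forall k x (y : T k), g (eqtype.dfwith x y) = g x) ->
  forall x x', g x = g x'.
Proof.
move=> gk x x'.
suff /(_ (enum 'I_n)) [y [gy yx']] (s : seq 'I_n) :
    exists y : prodspace T, g y = g x /\ {in s, forall k, y k = x' k}.
  rewrite -gy; congr g; apply: functional_extensionality_dep => k.
  by apply: yx'; rewrite mem_enum.
elim: s => [|k s [y [gy yx']]]; first by exists x.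
exists (eqtype.dfwith y (x' k)); split; first by rewrite gk.
move=> j; rewrite inE; case: eqtype.dfwithP => // i ki.
by rewrite eq_sym (negbTE ki)/=; exact: yx'.
Qed.

Lemma iter_ce_dfwith s f k x (y : T k) : k \in s ->
  iter_ce mu s f (eqtype.dfwith x y) = iter_ce mu s f x.
Proof.
elim: s x => //= l s IH x; rewrite inE; have [<- _|kl ks] := eqVneq k l.
  exact: ce_dfwith.
apply: eq_Rintegral => z _; rewrite /subst_at dfwithC//; exact: IH.
Qed.

Lemma Rint_iter_ce s f : bmeas f ->
  \int[prod_measure mu]_x iter_ce mu s f x = \int[prod_measure mu]_x f x.
Proof.
by move=> bf; elim: s => //= k s IH; rewrite Rint_ce//; exact: bmeas_iter_ce.
Qed.

Lemma iter_ce_enum f x : bmeas f ->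
  iter_ce mu (enum 'I_n) f x = \int[prod_measure mu]_x f x.
Proof.
move=> bf; rewrite -(Rint_iter_ce (enum 'I_n) bf).
rewrite -[LHS](Rint_cst (prod_measure mu)); apply: eq_Rintegral => x' _.
by apply: invariant_constant => k {}x y; rewrite iter_ce_dfwith// mem_enum.
Qed.

End constants.

Theorem proposition4 (R : realType) (n : nat) (d : 'I_n -> measure_display)
    (T : forall k : 'I_n, measurableType (d k))
    (mu : forall k : 'I_n, probability (T k) R)
    (f : prodspace T -> R) (hf : bounded_measurable f) :
  ('E_(prod_measure mu)[sum_cond_variance mu f]
     <= 'V_(prod_measure mu)[f] + (4^-1 * interaction f ^+ 2)%:E)%E.
Proof.
have [mf [M0 [_ fM0]]] := hf.
pose M := M0 + 1.
have fM x : `|f x| <= M by apply: fM0; rewrite // ltrDl.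
have bf : bmeas f by split => //; exists M.
have bcv k g : bmeas g -> bmeas (cond_variance mu k g).
  by move=> bg; apply/bmeas_ce/bmeasX2; exact: bmeas_residual.
have EcvE k g : bmeas g -> \int[prod_measure mu]_x cond_variance mu k g x =
    sqnorm mu (residual mu k g).
  by move=> bg; rewrite Rint_ce//; apply/bmeasX2/bmeas_residual.
have VE : ('V_(prod_measure mu)[f] =
    (sqnorm mu (fun x => f x - iter_ce mu (enum 'I_n) f x))%:E)%E.
  rewrite /variance covariance.unlock expectation.unlock.
  have bV : bmeas (fun x => (f x - \int[prod_measure mu]_x f x) ^+ 2).
    by apply/bmeasX2/bmeasB => //; exact: bmeas_cst.
  rewrite -EFin_Rint; last first.
    by apply/bmeasX2/bmeasB => //; exact: bmeas_iter_ce.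
  by apply: eq_integral => x _; rewrite iter_ce_enum// expr2.
have EE : ('E_(prod_measure mu)[sum_cond_variance mu f] =
    (\sum_(k <- enum 'I_n) sqnorm mu (residual mu k f))%:E)%E.
  rewrite unlock EFin_Rint; last by apply: bmeas_sum => k; exact: bcv.
  rewrite Rint_sum; last by move=> k; exact: bcv.
  by rewrite big_enum/=; congr EFin; apply: eq_bigr => k _; exact: EcvE.
rewrite VE EE -EFinD lee_fin.
apply: (le_trans (sum_residual_le mu (enum_uniq _) bf)); rewrite lerD2l.
rewrite big_enum/=; under eq_bigr do rewrite big_enum_cond/=.
have -> : \sum_(k < n) \sum_(l < n | k != l)
      sqnorm mu (residual mu k (residual mu l f)) =
    \int[prod_measure mu]_x \sum_(k < n) \sum_(l < n | k != l)
      cond_variance mu k (residual mu l f) x.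
  rewrite Rint_sum; last first.
    by move=> k; apply: bmeas_sum => l; exact/bcv/bmeas_residual.
  apply: eq_bigr => k _; rewrite Rint_sum; last first.
    by move=> l; exact/bcv/bmeas_residual.
  by apply: eq_bigr => l _; rewrite EcvE//; exact: bmeas_residual.
rewrite -[leRHS](Rint_cst (prod_measure mu)); apply: Rint_le.
- by do 2![apply: bmeas_sum => ?]; exact/bcv/bmeas_residual.
- exact: bmeas_cst.
move=> x; apply: (@le_trans _ _
  (4^-1 * \sum_(k < n) \sum_(l < n | k != l) mixed_diff_sup k l f x)).
  rewrite mulr_sumr; apply: ler_sum => k _; rewrite mulr_sumr.
  apply: ler_sum => l kl; rewrite mulrC.
  exact: cond_variance_residual_le fM _ _ _ _ mf kl.
by rewrite ler_pM2l ?invr_gt0//; exact: sum_mixed_diff_sup_le fM x.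
Qed.
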